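(* Assume that for the initial value problem $y'(t)=f(y(t))$, $y(t_0)=\tilde y$, with a smooth solution $y\in C^{p+1}([t_0,T])$, the standard explicit linear multistep method $$\sum_{j=0}^k\alpha_j u^{n+j}=\Delta t\sum_{j=0}^{k-1}\beta_j f(u^{n+j})$$ is convergent of order $p$. Assume that the function $\varphi$ is $(p+1)$-times continuously differentiable, and that neither $\varphi$ nor its derivatives vanish for $x>0$. Then the nonstandard linear multistep method $$\sum_{j=0}^k\alpha_j u^{n+j}=\varphi(\Delta t)\sum_{j=0}^{k-1}\beta_j f(u^{n+j})$$ (with the same coefficients $\alpha_j,\beta_j$) is convergent of order $p$ if and only if the following condition holds: if $p\ge1$, then $\varphi(0)=0$ and $\varphi'(0)=1$; and if $p\ge 2$, then $\varphi^{(i)}(0)=0$ for $2\le i\le p$.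
   Context: Here $f:\mathbb{R}^m\to\mathbb{R}^m$ with $m\ge 1$, $\tilde y\in\mathbb{R}^m$, and the initial value problem is assumed to have a unique global solution $y:[t_0,T]\to\mathbb{R}^m$. The grid points are $t_n=t_0+n\Delta t$, $n=0,1,\dots,\mathcal{N}$, with $t_{\mathcal N}=T$ and step size $\Delta t>0$, and $u^n$ approximates $y(t_n)$. The coefficients $\alpha_j,\beta_j$ are real constants, and $\varphi$ is a nonnegative real-valued function of one variable. Convergence of order $p$ is meant in the usual sense for linear multistep methods. *)

(* Defs.v *)
From HB Require Import structures.
From mathcomp Require Import all_boot all_order all_algebra.
From mathcomp Require Import all_classical all_reals all_analysis.

Set Implicit Arguments.
Unset Strict Implicit.
Unset Printing Implicit Defensive.

Import Order.TTheory GRing.Theory Num.Theory.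
Import numFieldNormedType.Exports.
Local Open Scope classical_set_scope.
Local Open Scope ring_scope.

(* Differentiation relative to a subset [D] of the line: the difference
   quotient only sees points of [D], so the derivatives are one-sided at the
   endpoints of an interval and the values of [g] outside [D] play no role.   *)
Definition diff_quot (R : realType) (V : normedModType R) (g : R -> V)
    (x z : R) : V :=
  (z - x)^-1 *: (g z - g x).

Definition has_deriv_on (R : realType) (V : normedModType R) (D : set R)
    (g : R -> V) (x : R) (l : V) : Prop :=
  diff_quot g x z @[z --> within D x^'] --> l.

Definition derivable_on (R : realType) (V : normedModType R) (D : set R)
    (g : R -> V) (x : R) : Prop :=
  exists l : V, has_deriv_on D g x l.

Definition deriv_on (R : realType) (V : normedModType R) (D : set R)
    (g : R -> V) (x : R) : V :=
  lim (diff_quot g x z @[z --> within D x^']).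

Definition derivn_on (R : realType) (V : normedModType R) (D : set R)
    (i : nat) (g : R -> V) : R -> V :=
  iter i (deriv_on D) g.

Definition Cn_on (R : realType) (V : normedModType R) (D : set R)
    (n : nat) (g : R -> V) : Prop :=
  (forall i : nat, (i < n)%N ->
     forall x : R, D x -> derivable_on D (derivn_on D i g) x) /\
  {within D, continuous (derivn_on D n g)}.

(* The library's [locally [lipschitz f x | x in setT]] localizes at points of
   the square, off the diagonal included; this is the textbook form.          *)
Definition locally_lipschitz (R : realType) (V W : normedModType R)
    (f : V -> W) : Prop :=
  forall x : V, exists2 U : set V, nbhs x U & [lipschitz f z | z in U].

Definition ivp_solution (R : realType) (m : nat) (f : 'rV[R]_m -> 'rV[R]_m)
    (t0 T : R) (ytilde : 'rV[R]_m) (y : R -> 'rV[R]_m) : Prop :=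
  y t0 = ytilde /\
  forall t : R, `[t0, T]%classic t -> has_deriv_on `[t0, T] y t (f (y t)).

Definition ivp_unique_solution (R : realType) (m : nat)
    (f : 'rV[R]_m -> 'rV[R]_m) (t0 T : R) (ytilde : 'rV[R]_m)
    (y : R -> 'rV[R]_m) : Prop :=
  ivp_solution f t0 T ytilde y /\
  forall z : R -> 'rV[R]_m, ivp_solution f t0 T ytilde z ->
    forall t : R, `[t0, T]%classic t -> z t = y t.

(* [u 0, ..., u N] satisfies the explicit k-step recursion in which the factor
   [psi h] multiplies the right-hand side: [psi = id] is the standard method,
   [psi = phi] the nonstandard one.                                           *)
Definition lmm_run (R : realType) (k m : nat)
    (alpha : 'I_k.+1 -> R) (beta : 'I_k -> R) (psi : R -> R)
    (f : 'rV[R]_m -> 'rV[R]_m) (h : R) (N : nat) (u : nat -> 'rV[R]_m) : Prop :=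
  forall n : nat, (n + k <= N)%N ->
    \sum_(j < k.+1) alpha j *: u (n + j)%N =
    psi h *: \sum_(j < k) beta j *: f (u (n + j)%N).

(* Convergence of order p is a property of the method, quantified over all
   initial value problems on R^m with a locally Lipschitz right-hand side and
   a C^(p+1) solution: starting errors O(h^p) must give errors O(h^p) at all
   grid points, on the grids t_n = t0 + n h with t_N = T.  The order of a
   convergent method is positive: O(1) errors are not convergence.            *)
Definition convergent_of_order (R : realType) (k m : nat)
    (alpha : 'I_k.+1 -> R) (beta : 'I_k -> R) (psi : R -> R) (p : nat) : Prop :=
  (0 < p)%N /\
  forall (f : 'rV[R]_m -> 'rV[R]_m) (t0 T : R) (ytilde : 'rV[R]_m)
         (y : R -> 'rV[R]_m),
    t0 < T ->
    locally_lipschitz f ->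
    ivp_unique_solution f t0 T ytilde y ->
    Cn_on `[t0, T] p.+1 y ->
    forall C0 : R, exists C h0 : R, 0 < h0 /\
      forall (N : nat) (h : R) (u : nat -> 'rV[R]_m),
        0 < h -> h <= h0 -> t0 + N%:R * h = T ->
        (forall j : nat, (j < k)%N ->
           `|u j - y (t0 + j%:R * h)| <= C0 * h ^+ p) ->
        lmm_run alpha beta psi f h N u ->
        forall n : nat, (n <= N)%N ->
          `|u n - y (t0 + n%:R * h)| <= C * h ^+ p.

Arguments convergent_of_order {R k} m alpha beta psi p.

(* Main.v *)
(* The two methods are compared on the same starting values.

   Convergence applied to y' = 0 scales, by linearity, to zero-stability of the
   homogeneous recursion, hence to a Duhamel bound for the forced one; applied
   to y' = 0 and y' = 1 it also gives rho(1) = 0 and sigma(1) <> 0.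

   If phi(h) - h = O(h^(p+1)), the difference w of a nonstandard and a standard
   run satisfies the recursion forced by
   phi(h) sum_j beta_j (f(u) - f(v)) + (phi(h) - h) sum_j beta_j f(v); Duhamel and a
   discrete Gronwall argument in a tube around the solution, where f is
   Lipschitz, give w = O(h^p). Consistency of the standard method is not needed,
   since v is already known to converge.

   Conversely, for y' = 1 the difference w of two runs with exact starting values
   satisfies sum_j alpha_j w_(n+j) = (phi(h) - h) sigma(1). As rho(1) = 0, summing
   over n telescopes the left side to at most k boundary terms of size O(h^p), while
   the right side has about 1/h equal terms; so phi(h) - h = O(h^(p+1)) along
   h = 1/N. By Taylor's formula this forces the p-jet of phi at 0. *)

Require Import Defs.
From mathcomp Require Import all_boot all_order all_algebra.
From mathcomp Require Import all_classical all_reals all_analysis.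
From mathcomp Require Import zify ring lra.
Import Order.TTheory GRing.Theory Num.Theory.
Import numFieldNormedType.Exports.
Local Open Scope classical_set_scope.
Local Open Scope ring_scope.

(** * Derivatives relative to a subset of the line *)

(** Clearing the denominator removes the puncture, since at [z = x] both sides vanish. *)
Lemma has_deriv_onP (R : realType) (V : normedModType R) (D : set R)
    (g : R -> V) (x : R) (l : V) :
  has_deriv_on D g x l <-> forall e : R, 0 < e ->
    \forall z \near x, D z -> `|g z - g x - (z - x) *: l| <= e * `|z - x|.
Proof.
have E z : z != x ->
    `|g z - g x - (z - x) *: l| = `|l - diff_quot g x z| * `|z - x|.
  move=> zx; have zx0 : z - x != 0 by rewrite subr_eq0.
  rewrite -normrN opprB mulrC -normrZ /diff_quot scalerBr scalerA mulfV //.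
  by rewrite scale1r.
rewrite /has_deriv_on; split=> [/cvgrPdist_le H e e0|H].
  have := H _ e0; rewrite /= !near_withinE; apply: filterS => z Hz Dz.
  have [->|zx] := eqVneq z x; first by rewrite !subrr scale0r subrr !normr0 mulr0.
  by rewrite E // ler_wpM2r //; exact: Hz.
apply/cvgrPdist_le => e e0; rewrite /= !near_withinE.
apply: filterS (H _ e0) => z Hz zx /Hz.
by rewrite E // ler_pM2r // normr_gt0 subr_eq0.
Qed.

(** The points [x + s * (y - x)] with small [s > 0] lie in [D] and tend to [x]. Properness makes the
    limit in [deriv_on] unique. *)
Lemma within_dnbhs_proper (R : realType) (D : set R) (x y : R) :
  is_interval D -> D x -> D y -> x != y -> ProperFilter (within D x^').
Proof.
move=> iD Dx Dy xy; split; last by apply: within_filter.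
rewrite /within/= => /nbhs_ballP[e /= e0 H].
pose s := Num.min 1 (e / 2 / `|y - x|).
have yx0 : 0 < `|y - x| by rewrite normr_gt0 subr_eq0 eq_sym.
have s0 : 0 < s by rewrite lt_min ltr01 !divr_gt0.
have s1 : s <= 1 by rewrite ge_min lexx.
apply: (H (x + s * (y - x))).
- rewrite /ball/= opprD addNKr normrN normrM (gtr0_norm s0).
  rewrite -ltr_pdivlMr // (@le_lt_trans _ _ (e / 2 / `|y - x|)) ?ge_min ?lexx ?orbT //.
  by rewrite ltr_pM2r ?invr_gt0 //; lra.
- by rewrite -subr_eq0 addrAC subrr add0r mulf_neq0 ?(gt_eqF s0) // subr_eq0 eq_sym.
- have [xly|ylx] := leP x y.
    by apply: (iD x y) => //; apply/andP; split; nra.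
  by apply: (iD y x) => //; apply/andP; split; nra.
Qed.

Lemma deriv_onE (R : realType) (V : normedModType R) (D : set R) (g : R -> V)
    (x y : R) (l : V) :
  is_interval D -> D x -> D y -> x != y -> has_deriv_on D g x l ->
  deriv_on D g x = l.
Proof.
move=> iD Dx Dy xy gl.
have pf := within_dnbhs_proper _ _ _ _ iD Dx Dy xy.
by apply: cvg_lim gl; exact: norm_hausdorff.
Qed.

Lemma has_deriv_on_continuous (R : realType) (V : normedModType R) (D : set R)
    (g g' : R -> V) :
  (forall x, D x -> has_deriv_on D g x (g' x)) -> {within D, continuous g}.
Proof.
move=> H; apply/subspace_continuousP => x Dx.
have /has_deriv_onP/(_ _ ltr01) := H x Dx.
move=> H1; apply/cvgrPdist_le => e e0; rewrite near_withinE.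
(* With tolerance 1 in the derivative, [g z - g x] is at most [M * |z - x|] in norm for [z] in [D]
   near [x]. *)
pose M := 1 + `|g' x|.
have M0 : 0 < M by rewrite ltr_pwDl.
have : \forall z \near x, `|x - z| <= e / M.
  by apply: (@cvgr_dist_le _ _ _ (nbhs x) _ id) => //; rewrite divr_gt0.
apply: filterS2 H1 => z H1 H2 Dz.
rewrite distrC (_ : g z - g x = (g z - g x - (z - x) *: g' x) + (z - x) *: g' x); last by rewrite subrK.
apply: le_trans (ler_normD _ _) _.
apply: (@le_trans _ _ (M * `|x - z|)); last by rewrite mulrC -ler_pdivlMr.
by rewrite mulrDl (distrC x) lerD ?H1 // normrZ mulrC.
Qed.

Lemma has_deriv_onS (R : realType) (V : normedModType R) (D E : set R)
    (g : R -> V) (x : R) (l : V) :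
  D `<=` E -> has_deriv_on E g x l -> has_deriv_on D g x l.
Proof.
move=> DE /has_deriv_onP H; apply/has_deriv_onP => e /H.
by apply: filterS => z Hz /DE.
Qed.

Lemma has_deriv_onB (R : realType) (V : normedModType R) (D : set R)
    (g h : R -> V) (x : R) (l l' : V) :
  has_deriv_on D g x l -> has_deriv_on D h x l' ->
  has_deriv_on D (fun t => g t - h t) x (l - l').
Proof.
move=> /has_deriv_onP gl /has_deriv_onP hl'; apply/has_deriv_onP => e e0.
have e20 : 0 < e / 2 by rewrite divr_gt0.
apply: filterS2 (gl _ e20) (hl' _ e20) => z gz hz Dz.
rewrite (splitr e) mulrDl.
rewrite (_ : _ - _ = (g z - g x - (z - x) *: l) - (h z - h x - (z - x) *: l')).
  by rewrite (le_trans (ler_normB _ _)) // lerD ?gz ?hz.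
have swap (a b c d : V) : a - b - (c - d) = a - c - (b - d).
  by rewrite opprD addrACA -opprD.
by rewrite scalerBr (swap (g z)) (swap (g z - g x)).
Qed.


(** This bridge gives access to the ordinary mean value theorem and to derivatives of
    polynomials. *)
Lemma is_derive_has_deriv_on (R : realType) (g : R -> R^o) (x l : R) :
  is_derive x 1 g l <-> has_deriv_on setT g x l.
Proof.
have E e h : h != 0 ->
    (`|g (h + x) - g x - (h + x - x) *: l| <= e * `|h + x - x|) =
    (`|l - h^-1 *: ((g \o shift x) (h *: (1 : R)) - g x)| <= e).
  move=> h0; rewrite addrK /= -[in RHS](ler_pM2r (_ : 0 < `|h|)) ?normr_gt0 //.
  rewrite -normrM mulrBl [_%:A]mulr1 -[X in _ = (`|_ - X| <= _)]mulrC mulVKf //.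
  by rewrite -normrN opprB [l * h]mulrC.
split=> [[dg gl]|/has_deriv_onP H].
  have cg : (fun h => h^-1 *: ((g \o shift x) (h *: (1 : R)) - g x)) @ 0^' --> l.
    by rewrite -gl.
  apply/has_deriv_onP => e e0; apply/nbhs0P.
  have /cvgrPdist_le/(_ _ e0) := cg; rewrite near_withinE.
  apply: filterS => h Hh _; have [->|h0] := eqVneq h 0.
    by rewrite addr0 !subrr scale0r subrr !normr0 mulr0.
  by rewrite [x + h]addrC E //; exact: Hh.
have cg : (fun h => h^-1 *: ((g \o shift x) (h *: (1 : R)) - g x)) @ 0^' --> l.
  apply/cvgrPdist_le => e e0; rewrite near_withinE.
  have /nbhs0P := H e e0.
  by apply: filterS => h + h0; rewrite [x + h]addrC E //; exact.
apply: DeriveDef; first by apply/cvg_ex; exists l.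
by apply: cvg_lim cg; exact: norm_hausdorff.
Qed.

Lemma has_deriv_onT (R : realType) (V : normedModType R) (D : set R)
    (g : R -> V) (x : R) (l : V) :
  nbhs x D -> has_deriv_on D g x l -> has_deriv_on setT g x l.
Proof.
move=> xD /has_deriv_onP H; apply/has_deriv_onP => e /H.
by apply: filterS2 xD => z Dz /(_ Dz).
Qed.

Lemma mean_value_on (R : realType) (a b : R) (g g' : R -> R^o) :
  a < b -> (forall x, `[a, b]%classic x -> has_deriv_on `[a, b] g x (g' x)) ->
  exists2 c, c \in `]a, b[ & g b - g a = g' c * (b - a).
Proof.
move=> ab H; apply: MVT => //; last exact: has_deriv_on_continuous H.
move=> x xab; apply/is_derive_has_deriv_on.
have ab_x : nbhs x `[a, b]%classic.
  have : \forall z \near x, z \in `]a, b[ by exact: near_in_itvoo.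
  by apply: filterS => z; exact: subset_itv_oo_cc.
exact: has_deriv_onT ab_x (H _ (nbhs_singleton ab_x)).
Qed.

(** * Taylor's formula at the endpoint 0 *)

Lemma has_deriv_on_horner (R : realType) (D : set R) (q : {poly R}) (x : R) :
  has_deriv_on D (horner q : R -> R^o) x q^`().[x].
Proof.
apply: (@has_deriv_onS _ _ _ setT) => //.
by apply/is_derive_has_deriv_on; exact: is_derive_poly.
Qed.

Definition taylor_poly (R : realType) (D : set R) (n : nat) (g : R -> R^o) :=
  \poly_(i < n) (derivn_on D i g 0 / i`!%:R).

Lemma deriv_taylor_poly (R : realType) (D : set R) (n : nat) (g : R -> R^o) :
  (taylor_poly R D n.+1 g)^`() = taylor_poly R D n (deriv_on D g).
Proof.
apply/polyP => i; rewrite coef_deriv !coef_poly ltnS.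
case: ifP => // _; last by rewrite mul0rn.
rewrite /derivn_on -iterSr -[LHS]mulr_natr factS natrM invfM -!mulrA.
by congr (_ * _); rewrite mulrCA mulVf ?mulr1 ?pnatr_eq0.
Qed.

Lemma Cn_on_deriv_on (R : realType) (V : normedModType R) (D : set R) (n : nat)
  (g : R -> V) : Cn_on D n.+1 g -> Cn_on D n (deriv_on D g).
Proof.
move=> [dg cg]; split; last by rewrite /derivn_on -iterSr.
by move=> i ni x Dx; rewrite /derivn_on -iterSr; exact: (dg i.+1).
Qed.

(** Induction on [n]: [g - P] vanishes at 0 and its derivative is the remainder of [g'] one order
    lower, so the mean value theorem gains a factor [h]. For [n = 0] the polynomial is zero and
    continuity at 0 gives the bound. *)
Lemma taylor_bound (R : realType) (n : nat) (g : R -> R^o) :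
  Cn_on `[0, +oo[ n g ->
  exists M, exists2 d, 0 < d & forall h, 0 <= h <= d ->
    `|g h - (taylor_poly R `[0, +oo[ n g).[h]| <= M * h ^+ n.
Proof.
elim: n g => [|n IH] g Cg.
  case: Cg => _ /subspace_continuousP cg.
  have D0 : `[0, +oo[%classic (0 : R) by rewrite /= in_itv /= lexx.
  have /cvgrPdist_le/(_ _ ltr01) := cg 0 D0.
  rewrite near_withinE => /nbhs_ballP[d /= d0 H].
  exists (1 + `|g 0|), (d / 2); first by rewrite divr_gt0.
  move=> h /andP[h0 hd].
  have hb : ball (0 : R) d h.
    by rewrite /ball /= sub0r normrN ger0_norm // (le_lt_trans hd) //; lra.
  have Dh : `[0, +oo[%classic h by rewrite /= in_itv /= h0.
  rewrite /taylor_poly poly_def big_ord0 horner0 subr0 mulr1.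
  rewrite -[g h](subrK (g 0)) (le_trans (ler_normD _ _)) // lerD //.
  by rewrite distrC; exact: H hb Dh.
have [M [d d0 H]] := IH _ (Cn_on_deriv_on _ _ _ _ _ Cg).
exists M, d => // h /andP[h0 hd].
have dg x : 0 <= x -> has_deriv_on `[0, +oo[ g x (deriv_on `[0, +oo[ g x).
  move=> x0; have Dx : `[0, +oo[%classic x by rewrite /= in_itv /= x0.
  have [l gl] := Cg.1 0%N isT x Dx.
  rewrite (@deriv_onE _ _ _ _ x (x + 1) l) //.
  - exact: interval_is_interval.
  - by rewrite /= in_itv /= andbT addr_ge0.
  - by rewrite eq_sym -subr_eq0 addrAC subrr add0r oner_neq0.
set P := taylor_poly _ _ _ _.
have P0 : P.[0] = g 0.
  by rewrite horner_coef0 coef_poly /= divr1.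
have [<-|hn0] := eqVneq 0 h.
  by rewrite P0 subrr normr0 exprS mul0r mulr0.
have {hn0}hp : 0 < h by rewrite lt_def eq_sym hn0.
have [x xh|c + E] := mean_value_on _ 0 h (fun t => g t - P.[t])
    (fun t => deriv_on `[0, +oo[ g t - P^`().[t]) hp.
  move: xh; rewrite /= in_itv /= => /andP[x0 _].
  apply: has_deriv_onB; last exact: has_deriv_on_horner.
  by apply: has_deriv_onS (dg x x0) => z; rewrite /= !in_itv /= => /andP[->].
rewrite in_itv /= => /andP[c0 ch].
move: E; rewrite P0 subrr !subr0 => ->.
rewrite normrM (gtr0_norm hp) exprSr mulrA ler_pM2r // deriv_taylor_poly.
have cd : 0 <= c <= d by rewrite ltW //= (le_trans _ hd) // ltW.
apply: le_trans (H c cd) _.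
(* The bound at [c > 0] forces [M] to be nonnegative, so [c ^+ n] may be replaced by [h ^+ n]. *)
have M0 : 0 <= M.
  rewrite -(@pmulr_lge0 _ (c ^+ n)) ?exprn_gt0 //.
  exact: le_trans (normr_ge0 _) (H c cd).
by rewrite ler_wpM2l // lerXn2r ?nnegrE ?ltW.
Qed.

(** * Test problems with constant right-hand side *)

Lemma has_deriv_on_affine (R : realType) (V : normedModType R) (D : set R)
    (c d : V) (g : R -> V) (x : R) :
  (forall t, D t -> g t = t *: c + d) -> D x -> has_deriv_on D g x c.
Proof.
move=> gE Dx; apply/has_deriv_onP => e e0; apply: (@nearW _ (nbhs x)) => z Dz.
rewrite !gE // opprD addrACA subrr addr0 -scalerBl subrr normr0.
exact: mulr_ge0 (ltW e0) (normr_ge0 _).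
Qed.

Lemma Cn_on_affine (R : realType) (V : normedModType R) (a b : R) (c d : V)
    (n : nat) (y : R -> V) :
  a < b -> (forall t, `[a, b]%classic t -> y t = t *: c + d) ->
  Cn_on `[a, b] n y.
Proof.
move=> ab yE.
have affine i : exists c' d' : V,
    forall t, `[a, b]%classic t -> derivn_on `[a, b] i y t = t *: c' + d'.
  elim: i => [|i [c' [d' IH]]]; first by exists c, d.
  exists 0, c' => t Dt; rewrite scaler0 add0r /derivn_on iterS.
  have Da : `[a, b]%classic a by rewrite /= in_itv /= lexx ltW.
  have Db : `[a, b]%classic b by rewrite /= in_itv /= lexx ltW.
  have Hc := has_deriv_on_affine _ _ _ _ _ _ _ IH Dt.
  have iD : is_interval `[a, b]%classic by exact: interval_is_interval.
  (* Uniqueness of the derivative needs a second point of the interval: [a] at the right endpoint,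
     [b] elsewhere. *)
  have [tb|tb] := eqVneq t b.
    by apply: (deriv_onE _ _ _ _ _ a) Hc => //; rewrite tb gt_eqF.
  exact: deriv_onE iD Dt Db tb Hc.
split=> [i _ x Dx|].
  have [c' [d' E]] := affine i.
  by exists c'; exact: has_deriv_on_affine E Dx.
have [c' [d' E]] := affine n.
apply: (has_deriv_on_continuous _ _ _ _ (fun=> c')) => x Dx.
exact: has_deriv_on_affine E Dx.
Qed.

Lemma normr_coord_le (R : realType) (m n : nat) (A : 'M[R]_(m, n)) i j :
  `|A i j| <= `|A|.
Proof.
by rewrite [leRHS]/Num.Def.normr /= mx_normrE; apply/bigmax_geP; right => /=; exists (i, j).
Qed.

(** Multiples of the all-ones row embed the line isometrically in R^m, so scalar recursions can test
    a method on R^m. *)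
Lemma norm_const_mx1 (R : realType) (m : nat) :
  (0 < m)%N -> `|const_mx 1 : 'rV[R]_m| = 1.
Proof.
case: m => // m _; apply/eqP; rewrite eq_le; apply/andP; split; last first.
  by have := normr_coord_le _ _ _ (const_mx 1 : 'rV[R]_m.+1) ord0 ord0; rewrite mxE normr1.
rewrite [leLHS]/Num.Def.normr /= mx_normrE; apply/bigmax_leP; split => //= ij _.
by rewrite mxE normr1.
Qed.

(** Uniqueness comes from the mean value theorem, applied to each coordinate of a solution. *)
Lemma ivp_unique_solution_const (R : realType) (m : nat) (c d : 'rV[R]_m) (T : R) :
  0 < T -> ivp_unique_solution (fun=> c) 0 T d (fun t => t *: c + d).
Proof.
move=> T0; split.
  by split=> [|t Dt]; [rewrite scale0r add0r|exact: has_deriv_on_affine Dt].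
move=> z [z0 dz] t /=; rewrite in_itv /= => /andP[t0 tT].
have [<-|tn0] := eqVneq 0 t; first by rewrite scale0r add0r.
have {tn0}tp : 0 < t by rewrite lt_def eq_sym tn0.
apply/rowP => i; rewrite !mxE.
have [x xt|x _] := mean_value_on _ 0 t (fun s => z s ord0 i) (fun=> c ord0 i) tp.
  have Dx : `[0, T]%classic x.
    by move: xt; rewrite /= !in_itv /= => /andP[->] /le_trans; exact.
  apply: (@has_deriv_onS _ _ _ `[0, T]%classic).
    by move=> s; rewrite /= !in_itv /= => /andP[->] /le_trans; exact.
  have /has_deriv_onP Hx := dz x Dx; apply/has_deriv_onP => e /Hx.
  apply: filterS => s Hs /Hs; apply: le_trans.
  by apply: le_trans (normr_coord_le _ _ _ _ ord0 i); rewrite !mxE.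
by rewrite z0 subr0 => /(canRL (subrK _)) ->; rewrite mulrC.
Qed.

Lemma locally_lipschitz_const (R : realType) (V W : normedModType R) (c : W) :
  @locally_lipschitz R V W (fun=> c).
Proof.
move=> x; exists setT; first exact: filterT.
apply: (@klipschitzW _ _ _ 0).
  exact: (@globally_properfilter _ _ (x, x)).
by move=> [u v] _ /=; rewrite subrr normr0 mul0r.
Qed.

(** * Limits along the step sizes 1/N *)

Lemma inv_nat_small (R : realType) (h0 : R) : 0 < h0 ->
  exists2 M : nat, (0 < M)%N & forall N : nat, (M <= N)%N -> N%:R^-1 <= h0.
Proof.
move=> h0p; exists (Num.truncn h0^-1).+1 => // N MN.
have N0 : (0 < N)%N by exact: leq_trans MN.
rewrite -[h0]invrK lef_pV2 ?posrE ?ltr0n ?invr_gt0 //.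
apply: le_trans (ltW (truncnS_gt _)) _.
by rewrite ler_nat.
Qed.

(** If [x > 0], a large [N] makes [C / N] at most [x / 2], a contradiction. *)
Lemma le0_of_inv_nat (R : realType) (x C : R) (M : nat) :
  (forall N : nat, (M <= N)%N -> (0 < N)%N -> x <= C * N%:R^-1) -> x <= 0.
Proof.
move=> H; rewrite leNgt; apply/negP => x0.
have C0 : 0 < `|C| + 1 by rewrite ltr_wpDl.
have [M' M'0 HM'] := inv_nat_small _ (x / (`|C| + 1) / 2)
  (divr_gt0 (divr_gt0 x0 C0) (ltr0n R 2)).
have N0 : (0 < maxn M M')%N by rewrite leq_max M'0 orbT.
have := HM' _ (leq_maxr M M'); have := H _ (leq_maxl M M') N0.
set i := _^-1; move=> xi ix.
have i0 : 0 < i by rewrite invr_gt0 ltr0n.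
have : C * i <= (`|C| + 1) * i.
  by rewrite ler_pM2r // (le_trans (ler_norm C)) // lerDl.
have : (`|C| + 1) * i <= (`|C| + 1) * (x / (`|C| + 1) / 2) by rewrite ler_pM2l.
have -> : (`|C| + 1) * (x / (`|C| + 1) / 2) = x / 2.
  by rewrite mulrA mulrCA divff ?gt_eqF // mulr1.
lra.
Qed.

(** * Linear recursions and Duhamel's formula *)

(** The iteration acts on whole sequences: step [n] overwrites only the entry [n + k]. Each entry is
    final once computed, and the diagonal [W i.+1 i] collects these values. *)
Lemma window_rec (T : Type) (k : nat) (s : nat -> T) (F : nat -> (nat -> T) -> T) :
  (forall n u v, (forall j, (j < k)%N -> u j = v j) -> F n u = F n v) ->
  exists u : nat -> T, (forall j, (j < k)%N -> u j = s j) /\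
    forall n, u (n + k)%N = F n (fun j => u (n + j)%N).
Proof.
move=> Fext.
pose step n (w : nat -> T) i := if i == (n + k)%N then F n (fun j => w (n + j)%N) else w i.
pose W := fix W n := if n is n'.+1 then step n' (W n') else s.
have Wst n d i : (i < n + k)%N -> W (n + d)%N i = W n i.
  elim: d => [|d IH] ink; first by rewrite addn0.
  rewrite addnS /= /step ifN ?IH // ltn_eqF // (leq_trans ink) //.
  by rewrite leq_add2r leq_addr.
exists (fun i => W i.+1 i); split=> [j jk|n].
  exact: (Wst 0%N j.+1 j).
have -> : W (n + k).+1 (n + k)%N = W n.+1 (n + k)%N.
  by rewrite -addSn Wst // addSn.
rewrite {1}/W -/W /step eqxx; apply: Fext => j jk.
by rewrite -addnS Wst // ltn_add2l.
Qed.

Section multistep.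
Variables (R : realType) (k : nat) (alpha : 'I_k.+1 -> R).

(* The characteristic polynomial rho evaluated at the shift operator. *)
Definition charop (V : lmodType R) (u : nat -> V) (n : nat) : V :=
  \sum_(j < k.+1) alpha j *: u (n + j)%N.

(** The leading coefficient is invertible, so each equation can be solved for [u (n + k)], as in an
    explicit method. *)
Lemma charop_rec (V : lmodType R) (s : nat -> V) (G : nat -> (nat -> V) -> V) :
  alpha ord_max != 0 ->
  (forall n u v, (forall j, (j < k)%N -> u j = v j) -> G n u = G n v) ->
  exists u : nat -> V, (forall j, (j < k)%N -> u j = s j) /\
    forall n, charop V u n = G n (fun j => u (n + j)%N).
Proof.
move=> ak Gext.
pose F n (u : nat -> V) := (alpha ord_max)^-1 *:
  (G n u - \sum_(j < k) alpha (widen_ord (leqnSn k) j) *: u j).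
have [n u v uv|u [us uF]] := window_rec V k s F.
  rewrite /F (Gext _ _ _ uv); congr (_ *: (_ - _)).
  by apply: eq_bigr => j _; rewrite uv.
exists u; split=> // n; rewrite /charop big_ord_recr /= uF /F.
by rewrite scalerA divff // scale1r addrC subrK.
Qed.

End multistep.

Lemma charop_eq0 (R : realType) (k : nat) (alpha : 'I_k.+1 -> R)
    (V : lmodType R) (u : nat -> V) :
  alpha ord_max != 0 -> (forall j, (j < k)%N -> u j = 0) ->
  (forall n, charop _ _ alpha _ u n = 0) -> forall n, u n = 0.
Proof.
move=> ak us ur; elim/ltn_ind => n IH; have [/us//|kn] := ltnP n k.
have := ur (n - k)%N; rewrite /charop big_ord_recr /= subnK // big1 ?add0r.
  by move/eqP; rewrite scaler_eq0 (negbTE ak) => /eqP.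
by move=> j _; rewrite IH ?scaler0 // -[ltnRHS](subnK kn) ltn_add2l.
Qed.

Lemma charopB (R : realType) (k : nat) (alpha : 'I_k.+1 -> R)
    (V : lmodType R) (u v : nat -> V) n :
  charop _ _ alpha _ (fun i => u i - v i) n =
  charop _ _ alpha _ u n - charop _ _ alpha _ v n.
Proof. by rewrite /charop -sumrB; apply: eq_bigr => j _; rewrite scalerBr. Qed.

(** Here [gamma] is the fundamental solution, the response to a unit impulse at index 0. Both sides
    have zero starting values and the same image under [charop], so they agree. *)
Lemma duhamel (R : realType) (k : nat) (alpha : 'I_k.+1 -> R) (V : lmodType R)
    (gamma : nat -> R^o) (w : nat -> V) :
  alpha ord_max != 0 ->
  (forall j, (j < k)%N -> gamma j = 0) ->
  (forall n, charop _ _ alpha _ gamma n = (n == 0%N)%:R) ->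
  (forall j, (j < k)%N -> w j = 0) ->
  forall n, w n = \sum_(l < n.+1 - k) gamma (n - l)%N *: charop _ _ alpha _ w l.
Proof.
move=> ak g0 gE w0 n; apply/eqP; rewrite -subr_eq0; apply/eqP; move: n.
apply: (charop_eq0 _ _ alpha) => // [j jk|n].
  rewrite w0 // sub0r (_ : (j.+1 - k = 0)%N) ?big_ord0 ?oppr0 //.
  by apply/eqP; rewrite subn_eq0.
rewrite charopB; apply/eqP; rewrite subr_eq0; apply/eqP.
rewrite [RHS]/charop.
(* The inner sums are extended to the common range [l <= n]; every added term has a [gamma] of index
   below [k], which vanishes. *)
transitivity (\sum_(j < k.+1) \sum_(l < n.+1)
    (alpha j * gamma (n - l + j)%N) *: charop _ _ alpha _ w l); last first.
  apply: eq_bigr => j _.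
  have le : ((n + j).+1 - k <= n.+1)%N.
    by rewrite leq_subLR addnS ltnS addnC leq_add2r -ltnS.
  rewrite (big_ord_widen_cond _ predT
    (fun l => gamma (n + j - l)%N *: charop _ _ alpha _ w l) le).
  rewrite scaler_sumr [RHS]big_mkcond /=; apply: eq_bigr => l _.
  have ln : (l <= n)%N by rewrite -ltnS.
  rewrite addnBAC //; case: ltnP => [_|lj]; first by rewrite scalerA.
  by rewrite g0 ?mulr0 ?scale0r //; lia.
rewrite exchange_big /=.
under eq_bigr do rewrite -scaler_suml -/(charop _ _ alpha R^o gamma _) gE.
rewrite (bigD1 ord_max) //= subnn eqxx scale1r big1 ?addr0 // => l lmax.
have ln : (l < n)%N.
  by rewrite ltn_neqAle -ltnS ltn_ord andbT; apply: contra lmax => /eqP E; apply/eqP/val_inj.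
by rewrite subn_eq0 leqNgt ln scale0r.
Qed.

(** The root condition, stated as a uniform bound on homogeneous solutions. Scalar sequences
    suffice, since vector-valued ones are reached through the fundamental solution. *)
Definition zero_stable (R : realType) (k : nat) (alpha : 'I_k.+1 -> R) (G : R) :=
  forall (B : R) (u : nat -> R^o), 0 < B -> (forall j, (j < k)%N -> `|u j| <= B) ->
  (forall n, charop _ _ alpha _ u n = 0) -> forall n, `|u n| <= G * B.

(** The fundamental solution shifted by one index solves the homogeneous recursion, so
    zero-stability bounds it, and Duhamel's formula carries the bound over to [w]. *)
Lemma forced_bound (R : realType) (k : nat) (alpha : 'I_k.+1 -> R) (G : R) :
  alpha ord_max != 0 -> zero_stable _ _ alpha G ->
  exists2 C : R, 0 <= C & forall (V : normedModType R) (w : nat -> V),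
    (forall j, (j < k)%N -> w j = 0) ->
    forall n, `|w n| <= C * \sum_(l < n.+1 - k) `|charop _ _ alpha _ w l|.
Proof.
move=> ak st.
have [//|gamma [g0 gE]] := charop_rec _ _ alpha R^o (fun=> 0)
   (fun n _ => (n == 0%N)%:R) ak.
pose B := `|gamma k| + 1.
have B0 : 0 < B by rewrite ltr_wpDl.
have gb n : `|gamma n.+1| <= G * B.
  apply: (st B (fun i => gamma i.+1)) => // [j|{}n].
    rewrite leq_eqVlt => /predU1P[->|/g0 ->]; first by rewrite lerDl.
    by rewrite normr0 ltW.
  rewrite -(_ : (n.+1 == 0%N)%:R = 0 :> R^o) // -gE /charop.
  by apply: eq_bigr => j _; rewrite addSn.
have GB0 : 0 <= G * B by exact: le_trans (normr_ge0 _) (gb 0%N).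
(* The shift leaves out [gamma 0], whose size is therefore added. *)
exists (G * B + `|gamma 0%N|) => [|V w w0 n]; first by rewrite addr_ge0.
rewrite {1}(duhamel _ _ _ _ _ _ ak g0 gE w0) (le_trans (ler_norm_sum _ _ _)) //.
rewrite mulr_sumr ler_sum // => l _; rewrite normrZ ler_wpM2r //.
by case: (n - l)%N => [|i]; rewrite ?lerDr // (le_trans (gb i)) // lerDl.
Qed.

(** * What convergence on constant fields says about rho and sigma *)

Section constant_field.
Variables (R : realType) (m k p : nat) (alpha : 'I_k.+1 -> R) (beta : 'I_k -> R)
  (psi : R -> R).
Hypotheses (m_gt0 : (1 <= m)%N)
  (conv : convergent_of_order m alpha beta psi p).

(** Convergence for [y' = c], [y(0) = d] on [0,1] with [h = 1/N], read along the all-ones direction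
    of R^m. *)
Lemma convergent_const_field (c d C0 : R) :
  exists C h0 : R, 0 < h0 /\ forall (N : nat) (u : nat -> R^o),
    (0 < N)%N -> N%:R^-1 <= h0 ->
    (forall j, (j < k)%N -> `|u j - (j%:R / N%:R * c + d)| <= C0 * N%:R^-1 ^+ p) ->
    (forall n, charop _ _ alpha _ u n = psi N%:R^-1 * (\sum_(j < k) beta j * c)) ->
    forall n, (n <= N)%N -> `|u n - (n%:R / N%:R * c + d)| <= C * N%:R^-1 ^+ p.
Proof.
pose e : 'rV[R]_m := const_mx 1.
have ne : `|e| = 1 by exact: norm_const_mx1.
have nZ (a : R) : `|a *: e| = `|a| by rewrite normrZ ne mulr1.
have [C [h0 [h0p H]]] := conv.2 (fun=> c *: e) 0 1 (d *: e)
  (fun t => t *: (c *: e) + d *: e) ltr01 (@locally_lipschitz_const _ _ _ _)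
  (@ivp_unique_solution_const _ _ _ _ _ ltr01)
  (Cn_on_affine _ _ _ _ _ _ _ _ ltr01 (fun _ _ => erefl)) C0.
exists C, h0; split=> // N u N0 Nh us ur n nN.
have i0 : 0 < N%:R^-1 :> R by rewrite invr_gt0 ltr0n.
have NN : 0 + N%:R * N%:R^-1 = 1 :> R by rewrite add0r divff // pnatr_eq0 -lt0n.
have E i : u i *: e - ((0 + i%:R * N%:R^-1) *: (c *: e) + d *: e) =
    (u i - (i%:R / N%:R * c + d)) *: e.
  by rewrite add0r scalerA scalerBl scalerDl.
have := H N N%:R^-1 (fun i => u i *: e) i0 Nh NN.
have starts j : (j < k)%N ->
    `|u j *: e - ((0 + j%:R * N%:R^-1) *: (c *: e) + d *: e)| <= C0 * N%:R^-1 ^+ p.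
  by move=> jk; rewrite E nZ us.
move=> /(_ starts); rewrite -nZ -E; apply => // i _.
transitivity (charop _ _ alpha _ u i *: e).
  by rewrite /charop scaler_suml; apply: eq_bigr => j _; rewrite scalerA.
rewrite ur -scalerA scaler_suml; congr (_ *: _).
by apply: eq_bigr => j _; rewrite scalerA.
Qed.

Lemma expr_inv_nat_le (N : nat) : (0 < N)%N -> N%:R^-1 ^+ p <= N%:R^-1 :> R.
Proof.
move=> N0; rewrite -[leRHS]expr1 ler_wiXn2l ?conv.1 ?invr_ge0 ?ler0n //.
by rewrite invf_le1 ?ltr0n // ler1n.
Qed.

(** For [y' = 0] with starting values 1 the run [u] is the same for every [N]. Its error tends to
    zero, so [u] is constantly 1, and the recursion reads rho(1) = 0. *)
Lemma sum_alpha_eq0 : alpha ord_max != 0 -> \sum_(j < k.+1) alpha j = 0.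
Proof.
move=> ak.
have [C [h0 [h0p H]]] := convergent_const_field 0 1 0.
have [//|u [us ur]] := charop_rec _ _ alpha R^o (fun=> 1) (fun _ _ => 0) ak.
have [M M0 HM] := inv_nat_small _ _ h0p.
have u1 n : u n = 1.
  apply/eqP; rewrite -subr_eq0 -normr_le0.
  apply: (le0_of_inv_nat _ _ `|C| (maxn M n)) => N.
  rewrite geq_max => /andP[MN nN] N0.
  have := H N u N0 (HM N MN) _ _ n nN; rewrite mulr0 add0r => E.
  apply: (@le_trans _ _ (C * N%:R^-1 ^+ p)).
    apply: E => [j jk|i]; first by rewrite us // mulr0 add0r subrr normr0 mul0r.
    by rewrite ur big1 ?mulr0 // => j _; rewrite mulr0.
  apply: le_trans (ler_wpM2r _ (ler_norm C)) _.
    by rewrite exprn_ge0 // invr_ge0.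
  by rewrite ler_wpM2l // expr_inv_nat_le.
rewrite -[RHS](ur 0%N); apply: eq_bigr => j _.
by rewrite u1 /GRing.scale /= mulr1.
Qed.

Lemma zero_stable_of_convergent : exists G : R, zero_stable _ _ alpha G.
Proof.
have [C [h0 [h0p H]]] := convergent_const_field 0 0 1.
have [M M0 HM] := inv_nat_small _ _ h0p.
exists C => B u B0 us ur n.
pose N := maxn M n.
have N0 : (0 < N)%N by rewrite leq_max M0.
(* Scaling by [q / B] turns the starting values into admissible errors of size [h^p] for [y' = 0];
   the bound [C * q] scales back to [C * B]. *)
pose q : R := N%:R^-1 ^+ p.
have q0 : 0 < q by rewrite exprn_gt0 // invr_gt0 ltr0n.
have := H N (fun i => q / B * u i) N0 (HM N (leq_maxl _ _)) _ _ n (leq_maxr _ _).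
have nq (x : R) : `|q / B * x| = q / B * `|x|.
  by rewrite normrM gtr0_norm // divr_gt0.
rewrite mulr0 addr0 subr0 nq -/q => E.
rewrite -(ler_pM2l (_ : 0 < q / B)) ?divr_gt0 //.
rewrite (_ : q / B * (C * B) = C * q); last by field; rewrite gt_eqF.
apply: E => [j jk|i].
  rewrite mulr0 addr0 subr0 nq mul1r mulrAC ler_pdivrMr // ler_pM2l //.
  exact: us.
rewrite [X in psi _ * X]big1 ?mulr0 => [|j _]; last by rewrite mulr0.
transitivity (q / B *: charop _ _ alpha _ u i); last by rewrite ur scaler0.
rewrite /charop scaler_sumr; apply: eq_bigr => j _.
by rewrite !scalerA [_ * alpha j]mulrC -scalerA.
Qed.

(** If sigma(1) = 0, the run for [y' = 1] solves the homogeneous recursion from starting values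
    below [k / N]. Zero-stability keeps it O(1/N), whereas convergence sends its value at [N] to
    1. *)
Lemma sum_beta_neq0 : psi = id -> alpha ord_max != 0 -> \sum_(j < k) beta j != 0.
Proof.
move=> psiE ak; apply/eqP => sb0.
have [G st] := zero_stable_of_convergent.
have [C [h0 [h0p H]]] := convergent_const_field 1 0 0.
have [M M0 HM] := inv_nat_small _ _ h0p.
suff : (1 : R) <= 0 by rewrite ler10.
apply: (le0_of_inv_nat _ _ (`|C| + G * k%:R) M) => N MN N0.
have i0 : 0 < N%:R^-1 :> R by rewrite invr_gt0 ltr0n.
have [//|u [us ur]] := charop_rec _ _ alpha R^o (fun j => j%:R / N%:R)
  (fun _ _ => 0) ak.
have uN : `|u N - 1| <= `|C| * N%:R^-1.
  have := H N u N0 (HM N MN) _ _ N (leqnn N).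
  rewrite divff ?pnatr_eq0 -?lt0n // mulr1 addr0 => E.
  apply: (@le_trans _ _ (C * N%:R^-1 ^+ p)).
    apply: E => [j jk|i]; first by rewrite us // mulr1 addr0 subrr normr0 mul0r.
    by rewrite ur -mulr_suml sb0 mul0r mulr0.
  apply: le_trans (ler_wpM2r _ (ler_norm C)) _; first by rewrite exprn_ge0 // ltW.
  by rewrite ler_wpM2l // expr_inv_nat_le.
(* For [k = 0] the bound [k / N] is zero and not admissible in [zero_stable]; there [u] vanishes
   outright. *)
have [k0|k0] := posnP k.
  have : u N = 0 by apply: (charop_eq0 _ _ alpha) => // j; rewrite k0.
  move=> uN0; move: uN; rewrite uN0 k0 sub0r normrN normr1 => uN.
  by rewrite mulr0 addr0.
have vN : `|u N| <= G * (k%:R / N%:R).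
  apply: st => // [|j jk]; first by rewrite divr_gt0 // ltr0n.
  by rewrite us // ger0_norm ?ler_wpM2r ?divr_ge0 // ?ler_nat ltnW.
have : `|1 : R| <= `|u N - 1| + `|u N|.
  rewrite distrC -{1}(subrK (u N) 1); exact: ler_normD.
by rewrite normr1 mulrDl -mulrA => /le_trans; apply; rewrite lerD.
Qed.

End constant_field.

(** * Necessity of the conditions on phi *)

(* All interior terms cancel because [rho 1 = 0]; only [k] boundary terms remain. *)
Lemma sum_charop_bound (R : realType) (k : nat) (alpha : 'I_k.+1 -> R)
    (w : nat -> R^o) (B : R) (M : nat) :
  \sum_(j < k.+1) alpha j = 0 -> (forall j, (j < k)%N -> w j = 0) ->
  (forall i, (i < M + k)%N -> `|w i| <= B) ->
  `|\sum_(n < M) charop _ _ alpha _ w n| <= (\sum_(j < k.+1) `|alpha j|) * (k%:R * B).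
Proof.
move=> a0 w0 wB.
have [k0|kp] := posnP k.
  rewrite big1 ?normr0 => [|n _].
    by rewrite mulr_ge0 ?sumr_ge0 // k0 mul0r.
  subst k; rewrite /charop big_ord1 -[alpha ord0](big_ord1 +%R alpha) a0.
  by rewrite scale0r.
have B0 : 0 <= B by apply: le_trans (wB 0%N _); rewrite ?ltn_addl.
rewrite exchange_big /=.
(* A shift by [j] drops the first [j] values, which are zero, and adds the [j] values from index [M]
   on. *)
have E (j : 'I_k.+1) : \sum_(n < M) alpha j *: w (n + j)%N =
    alpha j * \sum_(i < M) w i + alpha j * \sum_(i < j) w (M + i)%N.
  rewrite -scaler_sumr -mulrDr; congr (_ * _).
  transitivity (\sum_(i < M + j) w i); last by rewrite big_split_ord.
  rewrite addnC big_split_ord /= [X in _ = X + _]big1 ?add0r => [|i _].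
    by apply: eq_bigr => i _; rewrite addnC.
  by rewrite w0 // (leq_trans (ltn_ord i)) // -ltnS.
under eq_bigr do rewrite E.
rewrite big_split /= -mulr_suml a0 mul0r add0r.
rewrite (le_trans (ler_norm_sum _ _ _)) // mulr_suml ler_sum // => j _.
rewrite normrM ler_wpM2l // (le_trans (ler_norm_sum _ _ _)) //.
apply: (@le_trans _ _ (\sum_(i < j) B)).
  by apply: ler_sum => i _; apply: wB; rewrite ltn_add2l (leq_trans (ltn_ord i)) // -ltnS.
rewrite sumr_const card_ord -[leLHS]mulr_natl ler_wpM2r // ler_nat -ltnS //.
Qed.

Lemma step_function_error (R : realType) (m k p : nat)
    (alpha : 'I_k.+1 -> R) (beta : 'I_k -> R) (phi : R -> R) :
  (1 <= m)%N -> alpha ord_max != 0 ->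
  convergent_of_order m alpha beta id p ->
  convergent_of_order m alpha beta phi p ->
  exists K : R, exists M : nat, forall N : nat, (M <= N)%N -> (0 < N)%N ->
    `|phi N%:R^-1 - N%:R^-1| <= K * N%:R^-1 ^+ p.+1.
Proof.
move=> m0 ak cid cphi.
have s0 : \sum_(j < k) beta j != 0 by exact: sum_beta_neq0 m0 cid erefl ak.
have a0 := sum_alpha_eq0 _ _ _ _ _ _ _ m0 cid ak.
set s := \sum_(j < k) beta j in s0.
have [C [h0 [h0p H]]] := convergent_const_field _ _ _ _ _ _ _ m0 cid 1 0 0.
have [C' [h0' [h0p' H']]] := convergent_const_field _ _ _ _ _ _ _ m0 cphi 1 0 0.
have [M M0 HM] := inv_nat_small _ _ h0p.
have [M' M0' HM'] := inv_nat_small _ _ h0p'.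
pose A := \sum_(j < k.+1) `|alpha j|.
(* The factor 2 comes from [N <= 2 * (N - k)], valid for [N >= 2 * k]. Only [N - k] equations are
   summed, so that all indices stay on the grid. *)
exists (2 * (A * (k%:R * (C + C'))) / `|s|), (maxn (maxn M M') k.*2) => N.
rewrite !geq_max -andbA => /and3P[MN MN' kN] N0.
pose h : R := N%:R^-1.
have h_gt0 : 0 < h by rewrite invr_gt0 ltr0n.
have [//|v [vs vr]] := charop_rec _ _ alpha R^o (fun j => j%:R / N%:R)
  (fun _ _ => h * s) ak.
have [//|u [us ur]] := charop_rec _ _ alpha R^o (fun j => j%:R / N%:R)
  (fun _ _ => phi h * s) ak.
have vB n : (n <= N)%N -> `|v n - n%:R / N%:R| <= C * h ^+ p.
  move=> nN; rewrite -[n%:R / _]mulr1 -[_ * 1]addr0; apply: H => // [|j jk|i].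
  - exact: HM.
  - by rewrite vs // mulr1 addr0 subrr normr0 mul0r.
  - by rewrite vr -mulr_suml mulr1.
have uB n : (n <= N)%N -> `|u n - n%:R / N%:R| <= C' * h ^+ p.
  move=> nN; rewrite -[n%:R / _]mulr1 -[_ * 1]addr0; apply: H' => // [|j jk|i].
  - exact: HM'.
  - by rewrite us // mulr1 addr0 subrr normr0 mul0r.
  - by rewrite ur -mulr_suml mulr1.
have := sum_charop_bound _ _ alpha (fun i => u i - v i) ((C + C') * h ^+ p) (N - k) a0.
have -> : \sum_(n < N - k) charop _ _ alpha R^o (fun i => u i - v i) n =
    (N - k)%:R * ((phi h - h) * s).
  rewrite [RHS]mulr_natl; under eq_bigr do rewrite charopB ur vr -mulrBl.
  by rewrite sumr_const card_ord.
rewrite -/A => key.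
have {key} : `|(N - k)%:R * ((phi h - h) * s)| <= A * (k%:R * ((C + C') * h ^+ p)).
  apply: key => [j jk|i iN]; first by rewrite us // vs // subrr.
  have iN' : (i <= N)%N by lia.
  rewrite (_ : u i - v i = (u i - i%:R / N%:R) - (v i - i%:R / N%:R)).
    rewrite (le_trans (ler_normB _ _)) // mulrDl addrC lerD ?vB ?uB //.
  by rewrite opprB addrA subrK.
rewrite !normrM normr_nat => key.
have S0 : 0 < `|s| by rewrite normr_gt0.
have NN : (1 : R) <= 2 * h * (N - k)%:R.
  rewrite mulrAC ler_pdivlMr ?ltr0n // mul1r -natrM ler_nat.
  by lia.
rewrite -/h -(ler_pM2r S0) [leRHS](_ : _ = 2 * h * (A * (k%:R * ((C + C') * h ^+ p)))).
  apply: (@le_trans _ _ (2 * h * ((N - k)%:R * (`|phi h - h| * `|s|)))); last first.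
    by rewrite ler_pM2l // mulr_gt0.
  by rewrite [leRHS]mulrA ler_peMl // mulr_ge0.
by rewrite exprS; field; rewrite gt_eqF.
Qed.

(** Letting [N] tend to infinity kills the constant coefficient; dividing by [1/N] then lowers the
    degree. *)
Lemma coef_eq0_of_small (R : realType) (n M : nat) (c : nat -> R) (K : R) :
  (forall N : nat, (M <= N)%N -> (0 < N)%N ->
    `|\sum_(i < n) c i * N%:R^-1 ^+ i| <= K * N%:R^-1 ^+ n) ->
  forall i, (i < n)%N -> c i = 0.
Proof.
elim: n c => [//|n IH] c H.
have E N : (0 < N)%N -> \sum_(i < n.+1) c i * N%:R^-1 ^+ i =
    c 0%N + N%:R^-1 * \sum_(i < n) c i.+1 * N%:R^-1 ^+ i.
  move=> N0; rewrite big_ord_recl /= expr0 mulr1; congr (_ + _).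
  by rewrite mulr_sumr; apply: eq_bigr => i _; rewrite exprS mulrCA.
have c0 : c 0%N = 0.
  apply/eqP; rewrite -normr_le0.
  apply: (le0_of_inv_nat _ _ (`|K| + \sum_(i < n) `|c i.+1|) M) => N MN N0.
  pose h : R := N%:R^-1.
  have h0 : 0 < h by rewrite invr_gt0 ltr0n.
  have hi i : h ^+ i <= 1 by rewrite exprn_ile1 ?(ltW h0) // invf_le1 ?ler1n ?ltr0n.
  have := H N MN N0; rewrite E // -/h => Hh.
  rewrite -[c 0%N](addrK (h * \sum_(i < n) c i.+1 * h ^+ i)).
  rewrite (le_trans (ler_normB _ _)) // mulrDl lerD //.
    apply: le_trans Hh _; apply: (@le_trans _ _ (`|K| * h ^+ n.+1)).
      by rewrite ler_wpM2r ?ler_norm // exprn_ge0 // ltW.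
    by rewrite ler_wpM2l // exprS ler_piMr // ltW.
  rewrite normrM gtr0_norm // mulrC ler_wpM2r ?(ltW h0) //.
  rewrite (le_trans (ler_norm_sum _ _ _)) // ler_sum // => i _.
  by rewrite normrM ler_piMr // ger0_norm ?hi // exprn_ge0 // ltW.
case=> [_|i]; first exact: c0.
rewrite ltnS; apply: (IH (fun i => c i.+1)) => N MN N0.
have := H N MN N0; rewrite E // c0 add0r.
have h0 : 0 < N%:R^-1 :> R by rewrite invr_gt0 ltr0n.
by rewrite normrM gtr0_norm // exprS mulrCA ler_pM2l.
Qed.

(** Both [phi h - h] and the Taylor remainder are O(h^(p+1)) along [h = 1/N]. Hence so is their
    difference, a polynomial of degree at most [p], whose coefficients [c] must vanish. *)
Lemma step_function_jet (R : realType) (p M : nat) (phi : R -> R) (K : R) :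
  (0 < p)%N -> Cn_on `[0, +oo[ p.+1 (phi : R -> R^o) ->
  (forall N : nat, (M <= N)%N -> (0 < N)%N ->
    `|phi N%:R^-1 - N%:R^-1| <= K * N%:R^-1 ^+ p.+1) ->
  forall i, (i <= p)%N -> derivn_on `[0, +oo[ i (phi : R -> R^o) 0 = (i == 1%N)%:R.
Proof.
move=> p0 phiC H i ip.
have [K' [d d0 T]] := taylor_bound _ _ _ phiC.
have [M' M'0 HM'] := inv_nat_small _ _ d0.
pose c i := derivn_on `[0, +oo[ i (phi : R -> R^o) 0 / i`!%:R - (i == 1%N)%:R.
have ci : c i = 0.
  apply: (coef_eq0_of_small _ p.+1 (maxn M M') c (K + K')) => // N.
  rewrite geq_max => /andP[MN MN'] N0.
  pose h : R := N%:R^-1.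
  have h0 : 0 < h by rewrite invr_gt0 ltr0n.
  rewrite -/h (_ : \sum_(i < p.+1) _ = (phi h - h) -
      (phi h - (taylor_poly _ `[0, +oo[ p.+1 phi).[h])).
    rewrite (le_trans (ler_normB _ _)) // mulrDl lerD ?H //.
    by rewrite T // ltW //= HM'.
  rewrite horner_poly opprB addrC addrA subrK -[in RHS](expr1 h).
  under eq_bigr do rewrite mulrBl.
  rewrite sumrB; congr (_ - _).
  have p1 : (1 < p.+1)%N by [].
  rewrite (bigD1 (Ordinal p1)) //= mul1r big1 ?addr0 // => j j1.
  rewrite (_ : (j == 1%N :> nat) = false) ?mul0r //.
  by apply/negbTE; apply: contra j1 => /eqP E; apply/eqP/val_inj.
move/eqP: ci; rewrite subr_eq0 => /eqP ci.
have f0 : i`!%:R != 0 :> R by rewrite pnatr_eq0 -lt0n fact_gt0.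
rewrite -[LHS](divfK f0) ci; case: eqP => [->|_]; last by rewrite mul0r.
by rewrite mulr1.
Qed.

(** * Sufficiency: a Lipschitz tube and Gronwall's inequality *)

Lemma lipschitz_tube (R : realType) (V W : normedModType R) (f : V -> W)
    (y : R -> V) (a b : R) :
  locally_lipschitz f -> {within `[a, b], continuous y} ->
  exists d L : R, [/\ 0 < d, 0 <= L & forall t, a <= t <= b -> forall u v,
    `|u - y t| <= d -> `|v - y t| <= d ->
    `|f u - f v| <= L * `|u - v| /\ `|f u| <= L].
Proof.
move=> lf /subspace_continuousP cy.
(* One parameter [L] serves as Lipschitz constant, bound on [f] and inverse tube radius. Compactness
   then turns local validity for all large [L] into a uniform choice. *)
pose P (L t : R) := `[a, b]%classic t -> forall u v,
    `|u - y t| <= L^-1 -> `|v - y t| <= L^-1 ->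
    `|f u - f v| <= L * `|u - v| /\ `|f u| <= L.
have cov : \forall L \near +oo, `[a, b]%classic `<=` P L.
  move/compact_near_coveringP: (@segment_compact _ a b); apply.
  move=> x Dx; have [U /nbhs_ballP[r /= r0 rU] lU] := lf (y x).
  have r20 : 0 < r / 2 by rewrite divr_gt0.
  have [M [_ HM]] := lU.
  pose L0 := `|M| + 1.
  have L00 : 0 < L0 by rewrite ltr_wpDl.
  have L0f : forall u v, U u -> U v -> `|f u - f v| <= L0 * `|u - v|.
    move=> u v Uu Uv; apply: (HM L0 _ (u, v)); last by split.
    by rewrite (le_lt_trans (ler_norm M)) // ltrDl.
  have /cvgrPdist_lt/(_ _ r20) := cy x Dx; rewrite near_withinE => cx.
  (* The three entries give the Lipschitz bound, a tube radius below [r / 2] that keeps the tube in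
     the ball of radius [r] around [y x], and a bound on [f] there. *)
  pose L1 := Num.max (Num.max L0 (2 / r + 1)) (`|f (y x)| + L0 * r).
  exists ([set x' | `[a, b]%classic x' -> `|y x - y x'| < r / 2], [set L | L1 <= L]).
    by split; [exact: cx|apply: nbhs_pinfty_ge; exact: num_real].
  move=> [x' L] /= [yx' L1L] Dx' u v.
  have LL0 : L0 <= L by rewrite (le_trans _ L1L) // !le_max lexx.
  have Lr : L^-1 < r / 2.
    rewrite -[r / 2]invrK invf_div ltf_pV2 ?posrE ?divr_gt0 //; last exact: lt_le_trans L00 LL0.
    by rewrite (lt_le_trans _ L1L) // !lt_max ltrDl ltr01 orbT.
  have inU w : `|w - y x'| <= L^-1 -> `|y x - w| < r.
    move=> wy; rewrite (splitr r) -(subrK (y x') (y x)) -addrA.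
    rewrite (le_lt_trans (ler_normD _ _)) // ltrD //; first exact: yx'.
    by rewrite distrC (le_lt_trans wy).
  move=> /inU ux /inU vx.
  have Uu : U u by apply: rU; rewrite -ball_normE.
  have Uv : U v by apply: rU; rewrite -ball_normE.
  have Uy : U (y x) by apply: rU; exact: ballxx.
  split; first by rewrite (le_trans (L0f _ _ Uu Uv)) // ler_wpM2r.
  apply: (@le_trans _ _ (`|f (y x)| + L0 * r)); last first.
    by rewrite (le_trans _ L1L) // !le_max lexx orbT.
  rewrite -[f u](subrK (f (y x))) addrC (le_trans (ler_normD _ _)) // lerD2l.
  by rewrite (le_trans (L0f _ _ Uu Uy)) // ler_pM2l // distrC ltW.
have [L [L0 HL]] : exists L, 0 < L /\ `[a, b]%classic `<=` P L.
  near (pinfty_nbhs R) => L; exists L; split; near: L; first by apply: nbhs_pinfty_gt; exact: num_real.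
  exact: cov.
exists L^-1, L; split; [by rewrite invr_gt0|exact: ltW|move=> t tab].
by apply: HL; rewrite /= in_itv.
Unshelve. all: by end_near. Qed.

(** The recursive inequality may assume the conclusion at earlier indices. This permits a bootstrap:
    past bounds keep a run in the tube where the Lipschitz estimate holds. *)
Lemma discrete_gronwall (R : realType) (a b : R) (e : nat -> R) (N : nat) :
  0 <= b ->
  (forall n, (n <= N)%N -> (forall i, (i < n)%N -> e i <= a * (1 + b) ^+ i) ->
    e n <= a + b * \sum_(i < n) e i) ->
  forall n, (n <= N)%N -> e n <= a * (1 + b) ^+ n.
Proof.
move=> b0 H; elim/ltn_ind => n IH nN.
have IH' i : (i < n)%N -> e i <= a * (1 + b) ^+ i.
  by move=> ni; apply: IH => //; rewrite (leq_trans (ltnW ni)).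
apply: le_trans (H n nN IH') _.
(* The geometric sequence satisfies the recursion with equality. *)
have <- : a + b * \sum_(i < n) a * (1 + b) ^+ i = a * (1 + b) ^+ n.
  elim: (n) => [|i IHi]; first by rewrite big_ord0 mulr0 addr0 mulr1.
  by rewrite big_ord_recr mulrDr addrA IHi exprS; ring.
by rewrite lerD2l ler_wpM2l // ler_sum // => i _; exact: IH'.
Qed.

Lemma expr_1D_le_expR (R : realType) (b : R) (n N : nat) : 0 <= b ->
  (n <= N)%N -> (1 + b) ^+ n <= expR (N%:R * b).
Proof.
move=> b0 nN; rewrite expRM_natl.
apply: (@le_trans _ _ ((1 + b) ^+ N)); first by rewrite ler_weXn2l // lerDl.
by rewrite lerXn2r ?nnegrE ?expR_ge0 ?expR_ge1Dx // addr_ge0.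
Qed.

Lemma sum_shift_le (R : realType) (e : nat -> R) (a j n : nat) :
  (forall i, 0 <= e i) -> (a <= n - j)%N ->
  \sum_(l < a) e (l + j)%N <= \sum_(i < n) e i.
Proof.
move=> e0; have [->|a0 anj] := posnP a; first by rewrite big_ord0 sumr_ge0.
have /subnKC <- : (j + a <= n)%N by lia.
rewrite -addnA big_split_ord /= big_split_ord /=.
under eq_bigr do rewrite addnC.
by rewrite addrCA lerDl addr_ge0 // sumr_ge0.
Qed.

Lemma convergent_perturbation (R : realType) (m k p : nat)
    (alpha : 'I_k.+1 -> R) (beta : 'I_k -> R) (phi : R -> R) (K d1 : R) :
  (1 <= m)%N -> alpha ord_max != 0 ->
  convergent_of_order m alpha beta id p ->
  0 < d1 -> (forall h : R, 0 <= h <= d1 -> `|phi h - h| <= K * h ^+ p.+1) ->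
  convergent_of_order m alpha beta phi p.
Proof.
move=> m0 ak cid d10 phiK; split; first exact: cid.1.
(* For [k = 0], rho(1) = 0 would kill the leading coefficient. With [k >= 1] the Duhamel sum at [n]
   has at most [n] terms. *)
have k0 : (0 < k)%N.
  rewrite lt0n; apply/eqP => k0; subst k; move/eqP: ak (ak) => + ak; apply.
  rewrite -[RHS](sum_alpha_eq0 _ _ _ _ _ _ _ m0 cid ak) big_ord1.
  by congr (alpha _); apply: val_inj.
have [G st] := zero_stable_of_convergent _ _ _ _ _ _ _ m0 cid.
have [Gam Gam0 duh] := forced_bound _ _ _ _ ak st.
move=> f t0 T ytilde y t0T lf uy Cy C0.
have [C1 [h1 [h10 HC1]]] := cid.2 f t0 T ytilde y t0T lf uy Cy C0.
have cy : {within `[t0, T], continuous y}.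
  exact: has_deriv_on_continuous uy.1.2.
have [d [L [d0 L0 tube]]] := lipschitz_tube _ _ _ _ _ _ _ lf cy.
have Ks0 : 0 <= `|K| by [].
pose Bb := \sum_(j < k) `|beta j|.
have Bb0 : 0 <= Bb by rewrite sumr_ge0.
(* In Gronwall's inequality [b' * h] is the growth per step, and [a' * h^p] collects the forcing by
   [phi h - h] over all [(T - t0) / h] steps. *)
pose b' := Gam * ((1 + `|K|) * L * Bb).
have b'0 : 0 <= b' by rewrite !mulr_ge0 // addr_ge0.
pose a' := Gam * (`|K| * Bb * L * (T - t0)).
have Tt0 : 0 <= T - t0 by rewrite subr_ge0 ltW.
have a'0 : 0 <= a' by rewrite !mulr_ge0.
pose C2 := a' * expR (b' * (T - t0)).
have C20 : 0 <= C2 by rewrite mulr_ge0 // expR_ge0.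
(* [C3 * h^p] dominates the error of both runs; [h <= d / C3] and [h^p <= h] make it at most the
   tube radius. *)
pose C3 := `|C1| + C2 + 1.
have C30 : 0 < C3 by rewrite ltr_wpDl // addr_ge0.
exists (C1 + C2), (Num.min (Num.min h1 d1) (Num.min 1 (d / C3))).
split; first by rewrite !lt_min h10 d10 ltr01 divr_gt0.
move=> N h u h0; rewrite !le_min => /andP[/andP[hh1 hd1] /andP[hle1 hd]].
move=> NT us ur.
pose q := h ^+ p.
have q0 : 0 <= q by rewrite exprn_ge0 // ltW.
have qh : q <= h.
  by rewrite -[leRHS]expr1 ler_wiXn2l ?cid.1 ?(ltW h0).
have q1 : q <= 1 by exact: le_trans qh _.
pose y_ n := y (t0 + n%:R * h).
have phih : `|phi h - h| <= `|K| * h * q.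
  apply: le_trans (phiK h _) _; first by rewrite ltW.
  by rewrite exprS -mulrA ler_wpM2r ?ler_norm // mulr_ge0 // ltW.
have phih1 : `|phi h| <= (1 + `|K|) * h.
  rewrite -[phi h](subrK h) addrC (le_trans (ler_normD _ _)) // mulrDl mul1r.
  by rewrite gtr0_norm // lerD2l (le_trans phih) // ler_piMr // mulr_ge0 // ltW.
(* The standard run [v] takes its starting values from [u], so [w] starts from zero. *)
have [n s1 s2 s12|v [vs vr]] := charop_rec _ _ alpha 'rV[R]_m u
  (fun _ s => h *: \sum_(j < k) beta j *: f (s j)) ak.
  by congr (_ *: _); apply: eq_bigr => j _; rewrite s12.
have vy n : (n <= N)%N -> `|v n - y_ n| <= C1 * q.
  apply: (HC1 N h v h0 hh1 NT) => [j jk|i _]; last exact: vr.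
  by rewrite vs // us.
pose w n := u n - v n.
have ty n : (n <= N)%N -> t0 <= t0 + n%:R * h <= T.
  move=> nN; apply/andP; split; first by rewrite lerDl mulr_ge0 // ltW.
  by rewrite -NT lerD2l ler_wpM2r ?(ltW h0) // ler_nat.
have C3q : C3 * q <= d.
  apply: (@le_trans _ _ (C3 * h)); first by rewrite ler_pM2l.
  by rewrite mulrC -ler_pdivlMr.
have vd n : (n <= N)%N -> `|v n - y_ n| <= d.
  move=> /vy /le_trans; apply; apply: le_trans C3q; rewrite ler_wpM2r //.
  by rewrite /C3 (le_trans (ler_norm C1)) // -addrA lerDl addr_ge0.
have b0 : 0 <= b' * h by rewrite mulr_ge0 // ltW.
have expC2 n : (n <= N)%N -> a' * q * (1 + b' * h) ^+ n <= C2 * q.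
  move=> nN; rewrite mulrAC ler_wpM2r // ler_wpM2l //.
  rewrite (le_trans (expr_1D_le_expR _ _ _ _ b0 nN)) // ler_expR.
  by rewrite mulrCA -NT addrC addKr.
have main n : (n <= N)%N -> `|w n| <= a' * q * (1 + b' * h) ^+ n.
  move: n; apply: (discrete_gronwall _ _ _ (fun n => `|w n|)) => // n nN IH.
  (* The bounds already known for [w] before [n] keep [u] in the tube there. *)
  have ud i : (i < n)%N -> `|u i - y_ i| <= d.
    move=> ni; have iN : (i <= N)%N by rewrite (leq_trans (ltnW ni)).
    rewrite (_ : u i - y_ i = w i + (v i - y_ i)); last by rewrite addrA subrK.
    apply: le_trans C3q; rewrite (le_trans (ler_normD _ _)) //.
    rewrite /C3 !mulrDl mul1r -addrA addrCA lerD //.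
      by rewrite (le_trans (IH i ni)) ?expC2.
    by rewrite (le_trans (vy i iN)) // ler_wpDr // ler_wpM2r ?ler_norm.
  apply: le_trans (duh _ w _ n) _; first by move=> j jk; rewrite /w vs // subrr.
  have gl (l : 'I_(n.+1 - k)) : `|charop _ _ alpha _ w l| <=
      (1 + `|K|) * h * L * \sum_(j < k) `|beta j| * `|w (l + j)%N| +
      `|K| * h * q * (Bb * L).
    have lkn : (l + k <= n)%N by have := ltn_ord l; rewrite ltn_subRL ltnS addnC.
    rewrite charopB vr /charop ur ?(leq_trans lkn) //.
    have -> : phi h *: (\sum_(j < k) beta j *: f (u (l + j)%N)) -
        h *: (\sum_(j < k) beta j *: f (v (l + j)%N)) =
        phi h *: (\sum_(j < k) beta j *: (f (u (l + j)%N) - f (v (l + j)%N))) +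
        (phi h - h) *: (\sum_(j < k) beta j *: f (v (l + j)%N)).
      under [in RHS]eq_bigr do rewrite scalerBr.
      by rewrite sumrB scalerBr scalerBl addrA subrK.
    have tb (j : 'I_k) : `|f (u (l + j)%N) - f (v (l + j)%N)| <= L * `|w (l + j)%N| /\
        `|f (v (l + j)%N)| <= L.
      have ln : (l + j < n)%N by rewrite (leq_trans _ lkn) // ltn_add2l.
      have lN : (l + j <= N)%N by rewrite (leq_trans (ltnW ln)).
      split; first exact: (tube _ (ty _ lN) _ _ (ud _ ln) (vd _ lN)).1.
      exact: (tube _ (ty _ lN) _ _ (vd _ lN) (vd _ lN)).2.
    rewrite (le_trans (ler_normD _ _)) // !normrZ lerD //.
      rewrite -mulrA ler_pM // (le_trans (ler_norm_sum _ _ _)) // mulr_sumr.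
      by apply: ler_sum => j _; rewrite normrZ mulrCA ler_wpM2l //; exact: (tb j).1.
    rewrite ler_pM // (le_trans (ler_norm_sum _ _ _)) // mulr_suml.
    by apply: ler_sum => j _; rewrite normrZ ler_wpM2l //; exact: (tb j).2.
  apply: le_trans (ler_wpM2l Gam0 (ler_sum _ (fun l _ => gl l))) _.
  (* The perturbation terms add up to O(h^p). In the Lipschitz part each shifted sum of norms of [w]
     is at most the full sum, which leaves the factor [Bb]. *)
  rewrite big_split /= -mulr_sumr exchange_big /= mulrDr addrC lerD //.
    rewrite sumr_const card_ord -mulr_natl /a' -[leRHS]mulrA ler_wpM2l //.
    have -> : T - t0 = N%:R * h by rewrite -NT addrC addKr.
    rewrite [leRHS](_ : _ = N%:R * (`|K| * h * q * (Bb * L))); last by ring.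
    apply: ler_wpM2r; first by rewrite !mulr_ge0 // ltW.
    rewrite ler_nat (leq_trans _ nN) //.
    by rewrite leq_subLR -add1n leq_add2r.
  rewrite /b' [leRHS](_ : _ = Gam * ((1 + `|K|) * h * L * (Bb * \sum_(i < n) `|w i|))).
    rewrite ler_wpM2l //.
    apply: ler_wpM2l; first by rewrite !mulr_ge0 ?addr_ge0 // ltW.
    rewrite mulr_suml; apply: ler_sum => j _.
    rewrite -mulr_sumr ler_wpM2l //.
    apply: (sum_shift_le _ (fun i => `|w i|)) => //.
    by rewrite -[leqRHS]subSS leq_sub2l.
  by ring.
move=> n nN.
rewrite -/(y_ n) (_ : u n - y_ n = (v n - y_ n) + w n).
  rewrite mulrDl (le_trans (ler_normD _ _)) // lerD ?vy //.
  by rewrite (le_trans (main n nN)) ?expC2.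
by rewrite [RHS]addrC addrA subrK.
Qed.

Theorem theorem2 (R : realType) (m k p : nat)
    (alpha : 'I_k.+1 -> R) (beta : 'I_k -> R) (phi : R -> R)
    (hm : (1 <= m)%N)
    (halpha : alpha ord_max != 0)
    (hconv : convergent_of_order m alpha beta id p)
    (phi_ge0 : forall x : R, 0 <= x -> 0 <= phi x)
    (phi_C : Cn_on `[0, +oo[ p.+1 (phi : R -> R^o))
    (phi_neq0 : forall (i : nat) (x : R), (i <= p.+1)%N -> 0 < x ->
       derivn_on `[0, +oo[ i (phi : R -> R^o) x != 0) :
  convergent_of_order m alpha beta phi p <->
  ((1 <= p)%N ->
     phi 0 = 0 /\ derivn_on `[0, +oo[ 1 (phi : R -> R^o) 0 = 1) /\
  ((2 <= p)%N ->
     forall i : nat, (2 <= i <= p)%N ->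
       derivn_on `[0, +oo[ i (phi : R -> R^o) 0 = 0).
Proof.
have p0 := hconv.1; split=> [cphi|[H1 H2]].
  have [K [M HK]] := step_function_error _ _ _ _ _ _ _ hm halpha hconv cphi.
  have jet := step_function_jet _ _ _ _ _ p0 phi_C HK.
  split=> [_|_ i /andP[i2 ip]]; first by split; [exact: (jet 0%N)|exact: (jet 1%N)].
  by rewrite jet // gtn_eqF.
have [phi0 phi1] := H1 p0.
have [K [d d0 T]] := taylor_bound _ _ _ phi_C.
apply: (convergent_perturbation _ _ _ _ _ _ _ K d hm halpha hconv d0) => h hd.
(* The conditions say that the Taylor polynomial of degree [p] is [h] itself, so the Taylor bound is
   the required estimate of [phi h - h]. *)
suff E : (taylor_poly _ `[0, +oo[ p.+1 phi).[h] = h by rewrite -{2}E; exact: T.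
have jet i : (i <= p)%N -> derivn_on `[0, +oo[ i (phi : R -> R^o) 0 = (i == 1%N)%:R.
  by case: i => [|[|i]] ip; rewrite ?phi0 ?phi1 //; apply: H2 => //; exact: leq_trans ip.
have p1 : (1 < p.+1)%N by [].
rewrite horner_poly (bigD1 (Ordinal p1)) // jet // big1 => [|j j1].
  by rewrite /= addr0 divr1 mul1r.
rewrite (jet _ (ltn_ord j)) (_ : (j == 1%N :> nat) = false) ?mul0r //.
by apply/negbTE; apply: contra j1 => /eqP E; apply/eqP/val_inj.
Qed.
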